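(* Let $n\geq 12$ be an even integer and let $k\leq (n-8)/4$ be a positive integer. Then $A_n^k$ is a strongly real Beauville group.
   Context: $A_n^k$ denotes the direct product of $k$ copies of the alternating group $A_n$. Let $G$ be a finite group. For $x,y\in G$ let $\Sigma(x,y):=\bigcup_{i=1}^{|G|}\bigcup_{g\in G}\{(x^i)^g,(y^i)^g,((xy)^i)^g\}$, where $a^g$ denotes the conjugate of $a$ by $g$. A Beauville structure (of unmixed type) for $G$ is a pair of generating pairs $\{\{x_1,y_1\},\{x_2,y_2\}\}$ with $x_i,y_i\in G$, such that $\langle x_1,y_1\rangle=\langle x_2,y_2\rangle=G$ and $\Sigma(x_1,y_1)\cap\Sigma(x_2,y_2)=\{e\}$, where $e$ is the identity element of $G$. A group having a Beauville structure is called a Beauville group. A Beauville group $G$ is strongly real if it has a Beauville structure $\{\{x_1,y_1\},\{x_2,y_2\}\}$ for which there exist an automorphism $\phi\in\mathrm{Aut}(G)$ and elements $g_1,g_2\in G$ such that $g_i\phi(x_i)g_i^{-1}=x_i^{-1}$ and $g_i\phi(y_i)g_i^{-1}=y_i^{-1}$ for $i=1,2$. *)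

(* Defs.v *)
From mathcomp Require Import all_boot all_order all_algebra all_fingroup all_solvable.

Set Implicit Arguments.
Unset Strict Implicit.
Unset Printing Implicit Defensive.

Local Open Scope group_scope.

Definition Sigma (gT : finGroupType) (G : {group gT}) (x y : gT) : {set gT} :=
  \bigcup_(1 <= i < #|G|.+1) \bigcup_(g in G)
    [set (x ^+ i) ^ g; (y ^+ i) ^ g; ((x * y) ^+ i) ^ g].

(* The two generating pairs, and the elements of each pair, are ordered here;
   since [x * y] and [y * x] are conjugate, [Sigma G x y] is symmetric in [x]
   and [y], so the order is immaterial. *)
Definition beauville_structure (gT : finGroupType) (G : {group gT})
    (x1 y1 x2 y2 : gT) : Prop :=
  [/\ [/\ x1 \in G, y1 \in G, x2 \in G & y2 \in G],
      <<[set x1; y1]>> = G :> {set gT},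
      <<[set x2; y2]>> = G :> {set gT}
    & Sigma G x1 y1 :&: Sigma G x2 y2 = [set 1]].

(* [Aut G] is a set of permutations of the whole type [gT]: the automorphisms
   of [G], extended by the identity outside [G]. *)
Definition strongly_real_beauville (gT : finGroupType) (G : {group gT}) : Prop :=
  exists x1 y1 x2 y2 : gT,
    beauville_structure G x1 y1 x2 y2 /\
    exists phi g1 g2,
      [/\ phi \in Aut G,
          g1 \in G /\ g2 \in G,
          g1 * phi x1 * g1^-1 = x1^-1 /\ g1 * phi y1 * g1^-1 = y1^-1
        & g2 * phi x2 * g2^-1 = x2^-1 /\ g2 * phi y2 * g2^-1 = y2^-1].

Definition Alt_power (n k : nat) : {group {dffun forall i : 'I_k, {perm 'I_n}}} :=
  setXn_group (fun _ : 'I_k => Alt_group 'I_n).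

(* Main.v *)
Require Import Defs.
From mathcomp Require Import all_boot all_order all_algebra all_fingroup all_solvable.
From mathcomp Require Import zify.

(* Write N = n - 1, number the points 0, ..., N, and let the coordinate j < k
   use w = 2(j + 1) and p = 7 + 2j.
   - First pair: X = (0 1 ... N-1) and Y = (0 ... 2w-1)(2w ... N).  A nontrivial
     power of X fixes exactly one point; all cycles of Y and XY have even
     length, so their powers fix an even number of points.  X^-1 Y is the
     3-cycle (0 N 2w).
   - Second pair: x = (0 1 ... p-1) and y with xy = (3 4 ... N).  All of x, y, xy
     are single cycles of odd length fixing at least three points, so their
     nontrivial powers fix an odd number >= 3 of points.  The commutator of xy
     and x is (3 4)(0 p), and from it one gets a 3-cycle on 0, 2, p.
   Hence the two sets Sigma meet trivially, and both pairs generate A_n.  Both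
   are inverted by products of block reversals with N/2 (rounded down)
   transpositions, so these differ by an even permutation.  Finally a subgroup
   of A_n^k projecting onto every factor is everything as soon as any two
   coordinates are separated by an element trivial in exactly one of them: use
   a power of x in the second pair, and in the first the cube of the product of
   (0 N 2w) and its translate by 2w', which is a 3-cycle or a 5-cycle according
   to whether w = w'. *)

Set Implicit Arguments.
Unset Strict Implicit.
Unset Printing Implicit Defensive.
Local Open Scope group_scope.

(** * Groups of tuples *)

Section DffunGroup.

Variables (I : finType) (gT : I -> finGroupType).
Implicit Types g h : {dffun forall i, gT i}.

Lemma conjg_ffun g h i : (g ^ h) i = g i ^ h i.
Proof. by rewrite !conjgE !ffunE. Qed.

Lemma expg_ffun g m i : (g ^+ m) i = g i ^+ m.
Proof. by elim: m => [|m IH]; rewrite ?expg0 ?expgS ffunE ?IH. Qed.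

Lemma commg_ffun g h i : [~ g, h] i = [~ g i, h i].
Proof. by rewrite !commgEl ffunE conjg_ffun !ffunE. Qed.

End DffunGroup.

(** * Subdirect subgroups of a power of a nonabelian simple group *)

Section SubdirectPower.

Variables (I : finType) (gT : finGroupType) (A : {group gT}).
Variable H : {group {dffun forall i : I, gT}}.
Hypotheses (simpA : simple A) (nabA : ~~ abelian A).
Hypothesis sHA : H \subset setXn (fun _ : I => A).
Hypothesis projH : forall i a, a \in A -> exists2 h, h \in H & h i = a.

Let HA h i : h \in H -> h i \in A.
Proof. by move=> Hh; move/setXnP: (subsetP sHA _ Hh). Qed.

(** Because [H] projects onto [A], conjugating [h] inside [H] produces at coordinate [i] the whole
    [A]-class of [h i], which generates [A] by simplicity. In the applications [P] is triviality on
    a set of coordinates. *)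
Lemma full_coordinate (P : {dffun forall i : I, gT} -> Prop) i h :
  P 1 -> (forall g h, P g -> P h -> P (g * h)) ->
  (forall g h, P g -> P (g ^ h)) ->
  h \in H -> P h -> h i != 1 ->
  forall a, a \in A -> exists2 g, g \in H & P g /\ g i = a.
Proof.
move=> P1 PM PJ Hh Ph hi1.
have [_ simpA'] := simpleP _ simpA.
have Kin : <<(h i) ^: A>> = A.
  have /simpA' [|//] : <<(h i) ^: A>> <| A.
    rewrite /normal gen_subG class_subG ?HA ?subxx //=.
    by rewrite norms_gen // class_norm.
  move/trivgP=> /=; rewrite gen_subG => /subsetP/(_ (h i)).
  by rewrite class_refl => /(_ isT); rewrite inE (negPf hi1).
move=> a; rewrite -{1}Kin => /gen_prodgP [m [c cP ->]].
elim: m c cP => [|m IH] c cP.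
  by exists 1; rewrite ?group1 // big_ord0 ffunE.
rewrite big_ord_recl.
have [g Hg [Pg <-]] := IH (fun j => c (lift ord0 j)) (fun j => cP _).
have /imsetP [b Ab ->] := cP ord0.
have [u Hu <-] := projH i Ab.
exists (h ^ u * g); first by rewrite groupM // groupJ.
by split; [apply: PM => //; apply: PJ | rewrite mulg_ffun conjg_ffun].
Qed.

(** Separation gives elements trivial at one coordinate and arbitrary at another; commutators
    enlarge the set of trivial coordinates, since [A] is not abelian; any tuple is then assembled
    one coordinate at a time. *)
Lemma subdirect_simple_power :
  (forall i j, i != j ->
     exists2 h, h \in H & ((h j == 1) && (h i != 1)) || ((h i == 1) && (h j != 1))) ->
  H :=: setXn (fun _ : I => A).
Proof.
move=> sep; apply/eqP; rewrite eqEsubset sHA /=.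
have conj1 (j : I) (g h : {dffun forall i : I, gT}) : g j = 1 -> (g ^ h) j = 1.
  by move=> gj; rewrite conjg_ffun gj conj1g.
have oneside i j h : h \in H -> h j = 1 -> h i != 1 ->
    forall a, a \in A -> exists2 g, g \in H & g j = 1 /\ g i = a.
  move=> Hh hj hi; apply: (full_coordinate (P := fun g => g j = 1) _ _ _ Hh hj hi).
  - by rewrite ffunE.
  - by move=> g g' gj gj'; rewrite ffunE gj gj' mulg1.
  - by move=> g g'; apply: conj1.
have pairs i j : i != j ->
    forall a, a \in A -> exists2 g, g \in H & g j = 1 /\ g i = a.
  move=> /sep [h Hh /orP [] /andP [/eqP h1 h2]]; first exact: (oneside _ _ h).
  (* Here [h] is trivial at [i] instead: an element [g'] trivial at [i] and equal to [g] at [j]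
     cancels the coordinate [j] of [g]. *)
  move=> a Aa; have [g Hg gi] := projH i Aa.
  have [g' Hg' [g'1 g'2]] := oneside j i h Hh h1 h2 _ (HA j Hg).
  exists (g'^-1 * g); first by rewrite groupM ?groupV.
  by rewrite !ffunE g'1 g'2 gi mulVg invg1 mul1g.
(* The commutator of an element trivial on [s] with one trivial at [j] is
   trivial on [j :: s]. *)
have many (s : seq I) i : i \notin s ->
    forall a, a \in A -> exists2 g, g \in H & {in s, forall j, g j = 1} /\ g i = a.
  elim: s => [|j s IH].
    by move=> _ a Aa; have [g Hg gi] := projH i Aa; exists g.
  rewrite inE negb_or => /andP [ij nis].
  have /subsetPn [a Aa] : ~~ (A \subset 'C(A)) by [].
  rewrite -sub1set => nca.
  have /exists_inP [b Ab nab] : [exists b in A, [~ a, b] != 1].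
    apply: contraR nca; rewrite negb_exists_in => /forall_inP cab.
    rewrite sub1set; apply/centP=> b Ab; apply/commgP.
    by move: (cab b Ab); rewrite negbK.
  have [g Hg [gs gi]] := IH nis a Aa.
  have [h Hh [hj hi]] := pairs i j ij b Ab.
  apply: (full_coordinate (P := fun g => {in j :: s, forall l, g l = 1})
            (h := [~ g, h])).
  - by move=> l _; rewrite ffunE.
  - by move=> u v us vs l ls; rewrite ffunE us ?vs ?mulg1.
  - by move=> u v us l ls; apply/conj1/us.
  - by rewrite groupR.
  - move=> l; rewrite inE commg_ffun => /orP [/eqP->|ls].
      by rewrite hj commg1.
    by rewrite gs // comm1g.
  by rewrite commg_ffun gi hi.
apply/subsetP=> f /setXnP fA.
suff [h Hh hf] : exists2 h, h \in H & {in enum I, forall j, h j = f j}.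
  suff -> : f = h by [].
  by apply/ffunP=> j; rewrite hf ?mem_enum.
have := enum_uniq I; elim: (enum I) => [_|j s IH /= /andP [js us]].
  by exists 1; rewrite ?group1.
have [h Hh hf] := IH us.
(* The correction at [j] is trivial on [s], so the coordinates already matched are kept. *)
have [|g Hg [gs gj]] := many s j js ((h j)^-1 * f j).
  by rewrite groupM ?groupV ?fA ?HA.
exists (h * g); first by rewrite groupM.
move=> l; rewrite inE ffunE => /orP [/eqP->|ls]; first by rewrite gj mulKVg.
by rewrite gs // mulg1 hf.
Qed.

End SubdirectPower.

(** * Permutations *)

Section Permutations.

Variable T : finType.
Implicit Types (s g : {perm T}) (G : {group {perm T}}).

Lemma Alt_sub_tperm_pairs G (o c : T) :
  (forall a, a != o -> tperm o c * tperm o a \in G) -> 'Alt_T \subset G.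
Proof.
move=> GR.
(* The transpositions moving o generate Sym T; pair them up, with a spare
   [tperm o c] when the product is odd. *)
suff main s : tperm o c ^+ odd_perm s * s \in G.
  apply/subsetP=> s; rewrite Alt_even => /negPf es.
  by have := main s; rewrite es mul1g.
have : s \in <<[set tperm o y | y in T]>> by rewrite gen_tperm inE.
case/gen_prodgP=> m [f fP ->].
elim: m f fP => [|m IH] f fP; first by rewrite big_ord0 odd_perm1 mulg1 group1.
rewrite big_ord_recl; set s' := \prod_(i < m) _.
have {IH} : tperm o c ^+ odd_perm s' * s' \in G by apply: IH => i; apply: fP.
have /imsetP [y _ ->] := fP ord0.
rewrite odd_permM odd_tperm eq_sym.
have [->|yo] := eqVneq y o; first by rewrite tperm1 mul1g.
have GVR : tperm o y * tperm o c \in G.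
  by rewrite -groupV invMg !tpermV GR.
case: (odd_perm s') => /= Gs.
  rewrite mul1g.
  by have := groupM GVR Gs; rewrite mulgA -(mulgA (tperm o y)) tperm2 mulg1.
by have := groupM (GR y yo) Gs; rewrite mul1g mulgA.
Qed.

(** A 3-cycle can be read from any of its points; this moves the base point from [a] to [c]. *)
Lemma tperm_pair_rot (a b c : T) : a != b -> c != b ->
  tperm a b * tperm a c = tperm c a * tperm c b.
Proof.
by move=> ab cb; rewrite conjgC tpermJ tpermL (tpermD ab cb) (tpermC a).
Qed.

Definition fixpts s := [set x | s x == x].

Lemma card_fixptsJ s g : #|fixpts (s ^ g)| = #|fixpts s|.
Proof.
rewrite -(card_imset (fixpts s) (@perm_inj _ g)); apply: eq_card => x.
apply/idP/imsetP; first rewrite inE.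
  move=> /eqP sx; exists (g^-1 x); last by rewrite permKV.
  by rewrite inE -(inj_eq (@perm_inj _ g)) -permJ permKV sx.
by case=> y; rewrite inE => /eqP sy ->; rewrite inE permJ sy.
Qed.

(** The only nontrivial cycle of [g] is that of [a]. If [g ^+ m] fixes one of its points then,
    commuting with [g], it fixes them all. *)
Lemma fixptsX_cycle g (a : T) m :
  (forall x, g x != x -> x \in porbit g a) -> g ^+ m != 1 ->
  fixpts (g ^+ m) = fixpts g.
Proof.
move=> cyc gm1; apply/setP=> x; rewrite !inE; apply/eqP/eqP; last first.
  exact: permX_fix.
move=> gmx; apply/eqP; apply: contraR gm1 => gx.
apply/eqP/permP=> y; rewrite perm1.
have [gy|/cyc] := eqVneq (g y) y; first exact: permX_fix.
have := cyc _ gx; rewrite -eq_porbit_mem => /eqP <- /porbitP [j ->].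
by rewrite -!permM -!expgD addnC expgD permM gmx.
Qed.

Lemma even_fixptsX (col : T -> bool) g m :
  (forall x, col (g x) = ~~ col x) -> ~~ odd #|fixpts (g ^+ m)|.
Proof.
move=> colg.
rewrite -(cardsID [set x | col x]).
(* [g] exchanges the two colour classes of the fixed points of [g ^+ m]. *)
suff -> : fixpts (g ^+ m) :\: [set x | col x] =
    g @: (fixpts (g ^+ m) :&: [set x | col x]).
  by rewrite card_imset ?addnn ?odd_double //; apply: perm_inj.
have fixg x : (g x \in fixpts (g ^+ m)) = (x \in fixpts (g ^+ m)).
  by rewrite !inE -permM -expgS expgSr permM (inj_eq perm_inj).
apply/setP=> x; apply/idP/imsetP.
  rewrite in_setD => /andP [cx fx]; exists (g^-1 x); last by rewrite permKV.
  rewrite inE -fixg permKV fx /= inE; move: cx.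
  by rewrite -{1}(permKV g x) inE colg negbK.
by case=> y /setIP [fy]; rewrite inE => cy ->; rewrite in_setD fixg fy inE colg cy.
Qed.

Lemma odd_permX s m : odd_perm (s ^+ m) = odd m && odd_perm s.
Proof.
elim: m => [|m IH]; first by rewrite odd_perm1.
by rewrite expgS odd_permM IH /=; case: (odd m); case: (odd_perm s).
Qed.

Lemma porbit_step g (a x : T) : x \in porbit g a -> g x \in porbit g a.
Proof. by case/porbitP=> m ->; rewrite -permM -expgSr mem_porbit. Qed.

(** The premise is free of inverses, so it can be checked pointwise from formulas for [g] and
    [b]. *)
Lemma conjg_eqV g b : g * b * g = b -> g ^ b = g^-1.
Proof.
by move=> gbg; apply: (mulIg g); rewrite mulVg conjgE -!mulgA (mulgA g) gbg mulVg.
Qed.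

Lemma tperm_disjoint_commute (a b c d : T) :
  a != c -> a != d -> b != c -> b != d -> commute (tperm a b) (tperm c d).
Proof.
move=> ac ad bc bd; apply/commgP/conjg_fixP.
by rewrite tpermJ !tpermD // eq_sym.
Qed.

(** Two 3-cycles meet only in [o]. Conjugating the first by the inverse of the second gives a
    3-cycle on [a], [b], [c]; conjugating the first by the inverse of that one gives
    [tperm o c * tperm o a], which telescopes with the first. *)
Lemma tperm_pair_join G (o a b c d : T) : uniq [:: o; a; b; c; d] ->
  tperm o a * tperm o b \in G -> tperm o d * tperm o c \in G ->
  tperm o c * tperm o b \in G.
Proof.
rewrite /= !inE !negb_or => /and5P [/and4P [oa ob oc od] /and3P [ab ac ad]
  /andP [bc bd] cd _] GU GV.
have [Vo Va Vb] : [/\ (tperm o c * tperm o d) o = c,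
    (tperm o c * tperm o d) a = a & (tperm o c * tperm o d) b = b].
  by rewrite !permM tpermL !tpermD // eq_sym.
have GV' : tperm o c * tperm o d \in G by rewrite -groupV invMg !tpermV.
have GW : tperm c b * tperm c a \in G.
  by have := groupJ GU GV'; rewrite conjMg !tpermJ Vo Va Vb -groupV invMg !tpermV.
have [Wo Wa Wb] : [/\ (tperm c b * tperm c a) o = o,
    (tperm c b * tperm c a) a = c & (tperm c b * tperm c a) b = a].
  rewrite !permM tpermR tpermL [tperm c b o]tpermD 1?eq_sym //.
  by rewrite [tperm c b a]tpermD 1?eq_sym // tpermR tpermD 1?eq_sym.
have := groupM (groupJ GU GW) GU.
by rewrite conjMg !tpermJ Wo Wa Wb mulgA -(mulgA (tperm o c)) tperm2 mulg1.
Qed.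

(** The transpositions of [a], [b] and of [e], [f] are disjoint from everything else, so squaring
    kills them and leaves the square of a 3-cycle on [c], [d], [g]. *)
Lemma sqr_two_double_tperms (a b c d e f g : T) : uniq [:: a; b; c; d; e; f; g] ->
  (tperm a b * tperm c d * (tperm e f * tperm g d)) ^+ 2 = tperm g c * tperm g d.
Proof.
rewrite /= !inE !negb_or => U.
repeat match goal with H : is_true (_ && _) |- _ => case/andP: H => ? ? end.
have cE : commute (tperm c d) (tperm e f) by apply: tperm_disjoint_commute.
have aE : commute (tperm a b) (tperm e f) by apply: tperm_disjoint_commute.
rewrite -mulgA (mulgA (tperm c d)) cE -mulgA mulgA.
rewrite expgMn; last first.
  by apply: commuteM; apply: commute_sym; apply: commuteM;
     apply: tperm_disjoint_commute => //; rewrite eq_sym.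
rewrite (expgMn _ aE) !expgS !expg0 !mulg1 !tperm2 !mul1g mulgA.
congr (_ * _); rewrite -mulgA -{1}tpermV -conjgE tpermJ tpermR tpermD //.
Qed.

Lemma cube_tperm_pair (o a b : T) : a != o -> b != o ->
  (tperm o a * tperm o b) ^+ 3 = 1.
Proof.
move=> ao bo; have [<-|ab] := eqVneq a b; first by rewrite tperm2 expg1n.
have Ea : tperm o a * tperm o b * tperm o a = tperm a b.
  by rewrite -mulgA -{1}(tpermV o a) -conjgE tpermJ tpermL tpermD // eq_sym.
have Eb : tperm o b * tperm o a * tperm o b = tperm a b.
  by rewrite -mulgA -{1}(tpermV o b) -conjgE tpermJ tpermL tpermD 1?tpermC // eq_sym.
by rewrite !expgS expg0 mulg1 !mulgA Ea -mulgA -mulgA (mulgA (tperm o b)) Eb tperm2.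
Qed.

End Permutations.

(** * Block cycles and block reversals *)

(** Innermost conditions are split first, and arithmetically impossible branches are discarded at
    once to keep the number of cases small. *)
Ltac split_ifs :=
  repeat match goal with
  | |- context [if ?b then _ else _] =>
    lazymatch b with
    | context [if _ then _ else _] => fail
    | _ => let h := fresh "b" in case: (boolP b) => h; try (exfalso; lia)
    end
  end.

Lemma exists_ord n a : (a < n)%N -> exists i : 'I_n, i = a :> nat.
Proof. by move=> an; exists (Ordinal an). Qed.

Section NatPerm.
Variable n : nat.

(* The identity when [f] does not restrict to a permutation of 'I_n. *)
Definition nat_perm (f : nat -> nat) : {perm 'I_n} :=
  odflt 1 [pick s : {perm 'I_n} | [forall i : 'I_n, s i == f i :> nat]].

Lemma nat_permE f : (forall i, i < n -> f i < n)%N ->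
    (forall i j, i < n -> j < n -> f i = f j -> i = j)%N ->
  forall i : 'I_n, nat_perm f i = f i :> nat.
Proof.
move=> fn finj i; rewrite /nat_perm; case: pickP => [s /forallP /(_ i) /eqP //|].
pose F (i : 'I_n) := Ordinal (fn i (ltn_ord i)).
have Finj : injective F by move=> a b [] /finj ab; apply/val_inj/ab.
by move=> /(_ (perm Finj)) /forallP []; move=> j; rewrite permE.
Qed.

Lemma val_tperm (a b i : 'I_n) : tperm a b i =
  (if i == a :> nat then nat_of_ord b else if i == b :> nat then nat_of_ord a
   else i) :> nat.
Proof.
case: tpermP => [->|->|/eqP na /eqP nb]; rewrite ?eqxx //.
  by case: eqP.
by rewrite !val_eqE (negPf na) (negPf nb).
Qed.

Lemma card_interval a b : (b <= n)%N ->
  #|[set i : 'I_n | (a <= i < b)%N]| = (b - a)%N.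
Proof.
elim: b => [|b IH] bn; first by rewrite sub0n; apply: eq_card0 => i; rewrite !inE andbF.
case: (leqP a b) => ab; last first.
  by rewrite (_ : b.+1 - a = 0)%N; [apply: eq_card0 => i; rewrite !inE; lia | lia].
rewrite (_ : [set i | _] = Ordinal bn |: [set i : 'I_n | (a <= i < b)%N]).
  by rewrite cardsU1 IH ?inE /=; lia.
by apply/setP=> i; rewrite !inE -val_eqE /=; lia.
Qed.

Definition block_cycle s l := nat_perm
  (fun i => if s <= i < s + l then (if i.+1 == s + l then s else i.+1) else i)%N.
Definition block_rev s l := nat_perm
  (fun i => if s <= i < s + l then s + (s + l).-1 - i else i)%N.

Variables (s l : nat).
Hypothesis sln : (s + l <= n)%N.

Lemma block_cycleE i : block_cycle s l i =
  (if s <= i < s + l then (if i.+1 == s + l then s else i.+1) else i)%N :> nat.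
Proof.
rewrite nat_permE // => [{}i i_n | {}i j i_n j_n]; split_ifs; lia.
Qed.

Lemma block_revE i : block_rev s l i =
  (if s <= i < s + l then s + (s + l).-1 - i else i)%N :> nat.
Proof.
rewrite nat_permE // => [{}i i_n | {}i j i_n j_n]; split_ifs; lia.
Qed.

Lemma block_cycleX_fix m (i : 'I_n) : ~~ (s <= i < s + l)%N ->
  (block_cycle s l ^+ m) i = i.
Proof.
by move=> ni; apply: permX_fix; apply: ord_inj; rewrite block_cycleE (negPf ni).
Qed.

Lemma block_cycleXE m (i : 'I_n) a : (a < l)%N -> i = (s + a)%N :> nat ->
  (block_cycle s l ^+ m) i = (s + (a + m) %% l)%N :> nat.
Proof.
move=> al ia; elim: m => [|m IH]; first by rewrite perm1 addn0 modn_small.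
have l0 : (0 < l)%N by lia.
have -> : ((a + m.+1) %% l = ((a + m) %% l).+1 %% l)%N.
  by rewrite -[in RHS]addn1 modnDml addn1 addnS.
rewrite expgSr permM block_cycleE IH; have := ltn_pmod (a + m) l0.
move: (_ %% l)%N => r rl; have [e|ne] := eqVneq r.+1 l.
  by rewrite [in RHS]e modnn; split_ifs; lia.
by rewrite modn_small; [split_ifs; lia | lia].
Qed.

Lemma block_cycle_order : block_cycle s l ^+ l = 1.
Proof.
apply/permP=> i; rewrite perm1.
case: (boolP (s <= i < s + l)%N) => [si|/block_cycleX_fix //].
apply: ord_inj; rewrite (@block_cycleXE l i (i - s)); [|lia|lia].
by rewrite modnDr modn_small; lia.
Qed.

Lemma block_cycle_porbit (a x : 'I_n) : a = s :> nat -> block_cycle s l x != x ->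
  x \in porbit (block_cycle s l) a.
Proof.
move=> av mv; have sx : (s <= x < s + l)%N.
  by apply: contraR mv => /(block_cycleX_fix 1)/eqP.
apply/porbitP; exists (x - s)%N; apply: ord_inj.
by rewrite (@block_cycleXE _ _ 0) ?av ?add0n ?modn_small; lia.
Qed.

Lemma card_fixpts_block_cycle : (1 < l)%N -> #|fixpts (block_cycle s l)| = (n - l)%N.
Proof.
move=> l1; rewrite (_ : fixpts _ = ~: [set i : 'I_n | s <= i < s + l])%N.
  by rewrite cardsCs setCK card_ord card_interval; lia.
by apply/setP=> i; rewrite !inE -val_eqE /= block_cycleE; split_ifs; lia.
Qed.

End NatPerm.

(** Peeling off the transposition of the two end points leaves the reversal of the inner block, of
    length [l - 2]. *)
Lemma odd_block_rev n s l : (s + l <= n)%N -> odd_perm (block_rev n s l) = odd l./2.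
Proof.
have [m] := ubnP l; elim: m s l => // m IH s l lm sln.
case: l => [|[|l]] in lm sln *.
- rewrite (_ : block_rev n s 0 = 1) ?odd_perm1 //.
  by apply/permP=> i; apply: ord_inj; rewrite block_revE // perm1; split_ifs; lia.
- rewrite (_ : block_rev n s 1 = 1) ?odd_perm1 //.
  by apply/permP=> i; apply: ord_inj; rewrite block_revE // perm1; split_ifs; lia.
have [a av] : exists a : 'I_n, a = s :> nat.
  by apply: exists_ord; lia.
have [b bv] : exists b : 'I_n, b = (s + l.+1)%N :> nat.
  by apply: exists_ord; lia.
rewrite (_ : block_rev n s l.+2 = tperm a b * block_rev n s.+1 l).
  by rewrite odd_permM odd_tperm IH -?val_eqE /=; lia.
apply/permP=> i; apply: ord_inj; rewrite permM !block_revE ?val_tperm; try lia.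
split_ifs; lia.
Qed.

(** * The first pair *)

Section FirstPair.

Variables (N w : nat).
Hypotheses (N_odd : odd N) (w_even : ~~ odd w) (w_gt0 : (0 < w)%N)
  (w_lt : (2 * w + 1 < N)%N).

Definition first_x : {perm 'I_N.+1} := block_cycle N.+1 0 N.
Definition first_y : {perm 'I_N.+1} :=
  block_cycle N.+1 0 (2 * w) * block_cycle N.+1 (2 * w) (N.+1 - 2 * w).
Definition first_refl : {perm 'I_N.+1} :=
  block_rev N.+1 0 (2 * w) * block_rev N.+1 (2 * w) (N - 2 * w).

Let X := first_x.
Let Y := first_y.

Lemma first_yE i :
  Y i = (if i.+1 == 2 * w then 0 else if i == N :> nat then 2 * w else i.+1)%N :> nat.
Proof.
have := ltn_ord i; rewrite permM !block_cycleE; try lia.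
by split_ifs; lia.
Qed.

Lemma first_xE i :
  X i = (if i == N :> nat then N else if i.+1 == N then 0 else i.+1)%N :> nat.
Proof.
have := ltn_ord i; rewrite block_cycleE; try lia.
by split_ifs; lia.
Qed.

Lemma first_xX m (o j i : 'I_N.+1) :
  o = N :> nat -> (j + m < N)%N -> i = (j + m)%N :> nat ->
  (X ^+ m) o = o /\ (X ^+ m) j = i.
Proof.
move=> oE jm iE; split; first by apply: block_cycleX_fix; lia.
apply: ord_inj; rewrite (@block_cycleXE _ _ _ _ m j j); [|lia|lia|lia].
by rewrite modn_small; lia.
Qed.

(** [X] and [Y] differ only at the points [2w - 1], [N - 1] and [N]. *)
Lemma first_tau (o a d : 'I_N.+1) :
  o = N :> nat -> a = 0%N :> nat -> d = (2 * w)%N :> nat ->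
  X^-1 * Y = tperm o d * tperm o a.
Proof.
move=> oE aE dE; apply: (mulgI X); rewrite mulKVg.
apply/permP=> i; apply: ord_inj.
have := ltn_ord i; rewrite first_yE !permM !val_tperm first_xE oE aE dE.
by split_ifs; lia.
Qed.

(** [X] is even because its order divides the odd [N], and [Y] is [X] times a 3-cycle. *)
Lemma first_even : ~~ odd_perm X /\ ~~ odd_perm Y.
Proof.
have X0 : ~~ odd_perm X.
  have := odd_permX X N; rewrite N_odd block_cycle_order; last lia.
  by rewrite odd_perm1 /= => <-.
split=> //.
have [[o oE] [a aE] [d dE]] : [/\ exists o : 'I_N.+1, o = N :> nat,
   exists a : 'I_N.+1, a = 0%N :> nat & exists d : 'I_N.+1, d = (2 * w)%N :> nat].
  by split; apply: exists_ord; lia.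
rewrite -(mulKVg X Y) (first_tau oE aE dE) !odd_permM !odd_tperm (negPf X0).
by rewrite -!val_eqE /=; lia.
Qed.

(** [X^-1 * Y] and its conjugate by [X] are 3-cycles meeting only in [N], so they yield a 3-cycle on
    0, 1, [N]. Conjugating it by powers of [X] replaces 0, 1 by any consecutive points below [N],
    and products of these conjugates telescope. *)
Lemma Alt_sub_first (G : {group {perm 'I_N.+1}}) :
  X \in G -> Y \in G -> 'Alt_('I_N.+1) \subset G.
Proof.
move=> GX GY.
have [[o oE] [a aE] [d dE]] : [/\ exists o : 'I_N.+1, o = N :> nat,
   exists a : 'I_N.+1, a = 0%N :> nat & exists d : 'I_N.+1, d = (2 * w)%N :> nat].
  by split; apply: exists_ord; lia.
have [[b bE] [e eE]] : (exists b : 'I_N.+1, b = 1%N :> nat) /\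
   exists e : 'I_N.+1, e = (2 * w).+1 :> nat.
  by split; apply: exists_ord; lia.
have Gt : tperm o d * tperm o a \in G.
  by rewrite -(first_tau oE aE dE) groupM ?groupV.
have Gt1 : tperm o e * tperm o b \in G.
  have := groupJ Gt GX; rewrite conjMg !tpermJ.
  by rewrite (_ : X o = o) 1?(_ : X d = e) 1?(_ : X a = b) //;
     apply: ord_inj; rewrite first_xE; split_ifs; lia.
have G1 : tperm o b * tperm o a \in G.
  apply: (tperm_pair_join (d := e) _ Gt Gt1).
  by rewrite /= !inE -!val_eqE /=; lia.
have Gstep m : (m < N)%N -> forall i : 'I_N.+1, i = m :> nat ->
    tperm o a * tperm o i \in G.
  elim: m => [|m IH] mN i iE.
    by rewrite (_ : i = a) ?tperm2 ?group1 //; apply: ord_inj; lia.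
  have [j jE] : exists j : 'I_N.+1, j = m :> nat by apply: exists_ord; lia.
  have G2 : tperm o i * tperm o j \in G.
    have := groupJ G1 (groupX m GX); rewrite conjMg !tpermJ.
    have [|| -> ->] := @first_xX m o a j oE; [lia|lia|].
    by have [|| _ ->] := @first_xX m o b i oE; [lia|lia|].
  have G3 : tperm o j * tperm o i \in G by rewrite -groupV invMg !tpermV.
  have := groupM (IH (ltnW mN) j jE) G3.
  by rewrite mulgA -(mulgA (tperm o a)) tperm2 mulg1.
apply: (@Alt_sub_tperm_pairs _ _ o a) => i io; apply: (Gstep i) => //.
by have := ltn_ord i; move: io; rewrite -val_eqE /=; lia.
Qed.

Lemma first_gen : <<[set X; Y]>> = 'Alt_('I_N.+1).
Proof.
have [eX eY] := first_even.
apply/eqP; rewrite eqEsubset gen_subG; apply/andP; split.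
  by apply/subsetP=> g /set2P [] ->; rewrite Alt_even.
by apply: Alt_sub_first; rewrite mem_gen // !inE eqxx ?orbT.
Qed.

Lemma first_fixpts u m : u \in [:: X; Y; X * Y] -> u ^+ m != 1 ->
  #|fixpts (u ^+ m)| = 1%N \/ ~~ odd #|fixpts (u ^+ m)|.
Proof.
rewrite !inE => /or3P [] /eqP-> um1.
- left; have [a aE] : exists a : 'I_N.+1, a = 0%N :> nat by apply: exists_ord.
  rewrite (@fixptsX_cycle _ _ a) // ?card_fixpts_block_cycle; try lia.
  by move=> x; apply: block_cycle_porbit; lia.
(* Both blocks of [Y] start at an even point and have even length, so parity alternates along its
   cycles. *)
- right; apply: (@even_fixptsX _ (fun i : 'I_N.+1 => odd i)) => i.
  by have := ltn_ord i; rewrite first_yE; split_ifs; lia.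
(* [X * Y] adds 2 except for the jumps from [2w - 2] to 0, from [N - 1] to 1 and from [N] to [2w].
   The parity of [i./2] alternates along steps by 2, and at the first jump as [w] is even; flipping
   it on the even points from [2w] on repairs the other two jumps when [(N + 1)/2] is odd. *)
right; apply: (@even_fixptsX _ (fun i : 'I_N.+1 => odd i./2 (+)
   [&& odd N.+1./2, ~~ odd i & 2 * w <= i]%N)) => i.
have := ltn_ord i; rewrite permM first_yE first_xE; split_ifs; lia.
Qed.

(** The involution reflects the cycle of [X] as [i -> 2w - 1 - i] modulo [N], and it reverses each
    cycle of [Y], the second one about the fixed point [N]. *)
Lemma first_reflJ : X ^ first_refl = X^-1 /\ Y ^ first_refl = Y^-1.
Proof.
have E i : first_refl i = (if i < 2 * w then 2 * w - i.+1 else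
    if i == N :> nat then N else 2 * w + N - i.+1)%N :> nat.
  by have := ltn_ord i; rewrite permM !block_revE; try lia; split_ifs; lia.
have XE := first_xE; have YE := first_yE.
move: (first_refl) (X) (Y) E XE YE => b x y E XE YE.
split; apply: conjg_eqV; apply/permP=> i; apply: ord_inj; have := ltn_ord i.
  by rewrite !permM XE !E XE; split_ifs; lia.
by rewrite !permM YE !E YE; split_ifs; lia.
Qed.

Lemma odd_first_refl : odd_perm first_refl = odd N./2.
Proof. by rewrite odd_permM !odd_block_rev; lia. Qed.

End FirstPair.

(* For the first pair, [x^-1 * y] is the 3-cycle (0 N 2w), conjugated here to
   (d N d+2w): the word is the cube of a 3-cycle if [d = 2w], and of a 5-cycle
   for the other parameters. *)
Definition separating_word (gT : finGroupType) d (x y : gT) :=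
  ((x^-1 * y) * (x^-1 * y) ^ (x ^+ d)) ^+ 3.

(** * Separating coordinates by words in the first pair *)

Section SeparateFirst.

Variables (N w : nat).
Hypotheses (N_odd : odd N) (w_even : ~~ odd w) (w_gt0 : (0 < w)%N)
  (w_lt : (2 * w + 1 < N)%N).

Lemma separating_word_eq1 :
  separating_word (2 * w) (first_x N) (first_y N w) = 1.
Proof.
have [[o oE] [a aE] [d dE]] : [/\ exists o : 'I_N.+1, o = N :> nat,
   exists a : 'I_N.+1, a = 0%N :> nat & exists d : 'I_N.+1, d = (2 * w)%N :> nat].
  by split; apply: exists_ord; lia.
rewrite /separating_word (first_tau N_odd w_even w_gt0 w_lt oE aE dE) conjMg !tpermJ.
have [-> ->] : (first_x N ^+ (2 * w)) o = o /\ (first_x N ^+ (2 * w)) a = d.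
  by apply: (first_xX N_odd w_even w_gt0 w_lt oE); lia.
set e := (first_x N ^+ (2 * w)) d.
have eE : e = ((2 * w + 2 * w) %% N)%N :> nat.
  by rewrite (@block_cycleXE _ _ _ _ _ d d) ?add0n ?dE //; lia.
have e0 : e != a.
  rewrite -val_eqE /= eE aE -/(dvdn _ _) (_ : 2 * w + 2 * w = 2 * (2 * w))%N; last lia.
  rewrite Gauss_dvdr ?coprimen2 //; apply/negP => /dvdn_leq; lia.
have eo : e != o.
  by rewrite -val_eqE /= eE oE; have := ltn_pmod (2 * w + 2 * w) (odd_gt0 N_odd); lia.
(* The two 3-cycles share [o] and [d], and their product collapses to a conjugate of a single
   3-cycle. *)
have -> : tperm o d * tperm o a * (tperm o e * tperm o d) =
    (tperm o a * tperm o e) ^ tperm o d.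
  by rewrite conjgE tpermV !mulgA.
by rewrite -conjXg cube_tperm_pair ?conj1g // -val_eqE /= oE aE; lia.
Qed.

Lemma separating_word_neq1 v : v != w -> (0 < v)%N -> (2 * v + 1 < N)%N ->
  separating_word (2 * v) (first_x N) (first_y N w) != 1.
Proof.
move=> vw v0 vN.
have [[o oE] [a aE] [d dE]] : [/\ exists o : 'I_N.+1, o = N :> nat,
   exists a : 'I_N.+1, a = 0%N :> nat & exists d : 'I_N.+1, d = (2 * w)%N :> nat].
  by split; apply: exists_ord; lia.
have [b bE] : exists b : 'I_N.+1, b = (2 * v)%N :> nat by apply: exists_ord; lia.
rewrite /separating_word (first_tau N_odd w_even w_gt0 w_lt oE aE dE) conjMg !tpermJ.
have [-> ->] : (first_x N ^+ (2 * v)) o = o /\ (first_x N ^+ (2 * v)) a = b.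
  by apply: (first_xX N_odd w_even w_gt0 w_lt oE); lia.
set e := (first_x N ^+ (2 * v)) d.
have eE : e = ((2 * w + 2 * v) %% N)%N :> nat.
  by rewrite (@block_cycleXE _ _ _ _ _ d d) ?add0n ?dE //; lia.
(* The sum is below [2N], so reduction subtracts [N] at most once; [e = 0] is then excluded by
   parity. *)
have {eE} [e0 eN ev ew] : [/\ nat_of_ord e != 0, nat_of_ord e != N,
    nat_of_ord e != 2 * v & nat_of_ord e != 2 * w]%N.
  rewrite eE; have [lt|ge] := ltnP (2 * w + 2 * v) N.
    by rewrite modn_small //; split; lia.
  by rewrite -(subnK ge) modnDr modn_small; [split|]; lia.
set u := _ * _.
(* Three steps along the 5-cycle take [d] to [b], which differs from [d] because [v] differs from
   [w]. *)
have [ud ua ue] : [/\ u d = a, u a = e & u e = b].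
  by split; apply: ord_inj; rewrite !permM !val_tperm oE aE bE dE; split_ifs; lia.
apply/eqP => /permP /(_ d); rewrite perm1 permX /= ud ua ue => /(congr1 val) /=.
by rewrite bE dE; lia.
Qed.

End SeparateFirst.

(** * The second pair *)

Section SecondPair.

Variables (n p : nat).
Hypotheses (n_even : ~~ odd n) (p_odd : odd p) (p_ge : (7 <= p)%N)
  (p_le : (p + 3 <= n)%N).

Definition second_x : {perm 'I_n} := block_cycle n 0 p.
Definition second_z : {perm 'I_n} := block_cycle n 3 (n - 3).
Definition second_y : {perm 'I_n} := second_x^-1 * second_z.
Definition second_refl : {perm 'I_n} :=
  block_rev n 0 4 * block_rev n 4 (p - 4) * block_rev n p (n - p).

Let x := second_x.
Let y := second_y.
Let z := second_z.

Lemma second_xE i :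
  x i = (if i < p then if i.+1 == p then 0 else i.+1 else i)%N :> nat.
Proof. by rewrite block_cycleE ?add0n; [split_ifs|]; lia. Qed.

Lemma second_zE i :
  z i = (if i < 3 then i : nat else if i.+1 == n then 3 else i.+1)%N :> nat.
Proof. by have := ltn_ord i; rewrite block_cycleE; try lia; split_ifs; lia. Qed.

Lemma second_xy : x * y = z. Proof. exact: mulKVg. Qed.

Lemma second_yE i :
  y i = (if i == 0 :> nat then p else if i < 4 then i.-1 else if i < p then i : nat else
         if i.+1 == n then 3 else i.+1)%N :> nat.
Proof.
rewrite -(permKV x i); move: (x^-1 i) => j.
rewrite -permM second_xy second_zE second_xE.
by have := ltn_ord j; split_ifs; lia.
Qed.

Lemma second_even : ~~ odd_perm x /\ ~~ odd_perm y.
Proof.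
have x0 : ~~ odd_perm x.
  have := odd_permX x p; rewrite p_odd block_cycle_order; last lia.
  by rewrite odd_perm1 /= => <-.
split=> //; have := odd_permX z (n - 3); rewrite block_cycle_order; last lia.
rewrite odd_perm1 (_ : odd (n - 3)) /=; last lia.
by rewrite -second_xy odd_permM (negPf x0) /= => <-.
Qed.

(** [x * z] and [z * x] differ only at 2, [n - 1], where the images 3, 4 are exchanged, and at
    [p - 2], [p - 1], where 0, [p] are. *)
Lemma second_commutator (a3 a4 a0 ap : 'I_n) : a3 = 3%N :> nat -> a4 = 4%N :> nat ->
  a0 = 0%N :> nat -> ap = p :> nat ->
  [~ z, x] = tperm a3 a4 * tperm a0 ap.
Proof.
move=> E3 E4 E0 Ep; apply: (mulgI (x * z)).
have -> : x * z * [~ z, x] = z * x by rewrite commgEl conjgE !mulgA mulgK mulgV mul1g.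
apply/permP=> i; apply: ord_inj; rewrite -mulgA !permM !val_tperm.
have := ltn_ord i; rewrite !second_zE !second_xE !second_zE E3 E4 E0 Ep.
by split_ifs; lia.
Qed.

(** The commutator times its conjugate by [x ^+ 2] squares to a 3-cycle on 0, 2, [p]. As [z] fixes 0
    and 2 and is transitive on the points from 3 on, [p] can be replaced by any of these; only the
    point 1 needs a further conjugation, by [x^-1]. *)
Lemma Alt_sub_second (G : {group {perm 'I_n}}) :
  x \in G -> z \in G -> 'Alt_('I_n) \subset G.
Proof.
move=> Gx Gz.
have [a0 E0] : exists i : 'I_n, i = 0%N :> nat by apply: exists_ord; lia.
have [a1 E1] : exists i : 'I_n, i = 1%N :> nat by apply: exists_ord; lia.
have [a2 E2] : exists i : 'I_n, i = 2%N :> nat by apply: exists_ord; lia.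
have [a3 E3] : exists i : 'I_n, i = 3%N :> nat by apply: exists_ord; lia.
have [a4 E4] : exists i : 'I_n, i = 4%N :> nat by apply: exists_ord; lia.
have [a5 E5] : exists i : 'I_n, i = 5%N :> nat by apply: exists_ord; lia.
have [a6 E6] : exists i : 'I_n, i = 6%N :> nat by apply: exists_ord; lia.
have [ap Ep] : exists i : 'I_n, i = p :> nat by apply: exists_ord; lia.
have [aq Eq] : exists i : 'I_n, i = p.-1 :> nat by apply: exists_ord; lia.
have Gp : tperm a2 a0 * tperm a2 ap \in G.
  have Gc : [~ z, x] \in G by rewrite groupR.
  have := groupX 2 (groupM Gc (groupJ Gc (groupX 2 Gx))).
  rewrite (second_commutator E3 E4 E0 Ep) conjMg !tpermJ.
  have xx (i j : 'I_n) : (i.+2 < p)%N -> j = i.+2 :> nat -> (x ^+ 2) i = j.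
    move=> ip ji; apply: ord_inj; rewrite permX /= !second_xE ji.
    by split_ifs; lia.
  rewrite (xx a3 a5) ?(xx a4 a6) ?(xx a0 a2) ?E0 ?E3 ?E4 //; try lia.
  rewrite (_ : (x ^+ 2) ap = ap); last first.
    by apply: permX_fix; apply: ord_inj; rewrite second_xE; split_ifs; lia.
  rewrite sqr_two_double_tperms // -(map_inj_uniq val_inj) /=.
  by rewrite E0 E2 E3 E4 E5 E6 Ep !inE /=; lia.
have Gz3 (i : 'I_n) : (3 <= i)%N -> tperm a2 a0 * tperm a2 i \in G.
  (* Modulo [n - 3] the exponent is [i - p], made nonnegative by adding [n - 3]; it carries [p] to
     [i]. *)
  move=> i3; have := groupJ Gp (groupX ((i - 3) + ((n - 3) - (p - 3)))%N Gz).
  rewrite conjMg !tpermJ.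
  rewrite !(@block_cycleX_fix _ _ _ _ _ a2) ?(@block_cycleX_fix _ _ _ _ _ a0); try lia.
  rewrite (_ : (z ^+ _) ap = i) //; apply: ord_inj.
  rewrite (@block_cycleXE _ _ _ _ _ ap (p - 3)); [|lia|lia|lia].
  rewrite (_ : p - 3 + _ = i - 3 + (n - 3))%N; last lia.
  by rewrite modnDr modn_small; have := ltn_ord i; lia.
(* Conjugating the 3-cycle on 2, 0, 3 by [x^-1] gives one on 1, [p - 1], 2; rebased at 2, it
   telescopes with the one on 2, 0, [p - 1]. *)
have G1 : tperm a2 a0 * tperm a2 a1 \in G.
  have xV (i j : 'I_n) : x j = i -> x^-1 i = j by move=> <-; rewrite permK.
  have : tperm a1 aq * tperm a1 a2 \in G.
    have := groupJ (Gz3 a3 _) (groupVr Gx); rewrite conjMg !tpermJ.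
    have [x1 xq x2] : [/\ x a1 = a2, x aq = a0 & x a2 = a3].
      by split; apply: ord_inj; rewrite second_xE; split_ifs; lia.
    by rewrite (xV _ _ x1) (xV _ _ xq) (xV _ _ x2); apply; lia.
  rewrite tperm_pair_rot -?val_eqE /=; [|lia|lia].
  rewrite -groupV invMg !tpermV => Gq.
  have := groupM (Gz3 aq _) Gq.
  by rewrite mulgA -(mulgA (tperm a2 a0)) tperm2 mulg1; apply; lia.
apply: (@Alt_sub_tperm_pairs _ _ a2 a0) => i; rewrite -val_eqE /= => i2.
have [i3|i3] := leqP 3 i; first exact: Gz3.
have [i0|i0] := eqVneq (nat_of_ord i) 0%N.
  by rewrite (_ : i = a0) ?tperm2 ?group1 //; apply: ord_inj; lia.
by rewrite (_ : i = a1) //; apply: ord_inj; lia.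
Qed.

Lemma second_gen : <<[set x; y]>> = 'Alt_('I_n).
Proof.
have [ex ey] := second_even.
apply/eqP; rewrite eqEsubset gen_subG; apply/andP; split.
  by apply/subsetP=> g /set2P [] ->; rewrite Alt_even.
apply: Alt_sub_second; first by rewrite mem_gen // !inE eqxx.
by rewrite -second_xy groupM // mem_gen // !inE eqxx ?orbT.
Qed.

(** Nontrivial powers of [x], [y] and [x * y] fix exactly [n - p], [p - 4] and 3 points. *)
Lemma second_fixpts u m : u \in [:: x; y; x * y] -> u ^+ m != 1 ->
  odd #|fixpts (u ^+ m)| && (2 < #|fixpts (u ^+ m)|)%N.
Proof.
have [a0 E0] : exists i : 'I_n, i = 0%N :> nat by apply: exists_ord; lia.
have [a3 E3] : exists i : 'I_n, i = 3%N :> nat by apply: exists_ord; lia.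
rewrite !inE => /or3P [] /eqP-> um1.
- rewrite (@fixptsX_cycle _ _ a0) // ?card_fixpts_block_cycle; try lia.
  by move=> i; apply: block_cycle_porbit; lia.
(* The nontrivial cycle of [y] is walked from 3 in the order 3, 2, 1, 0, [p], [p + 1], ...,
   [n - 1]. *)
- rewrite (@fixptsX_cycle _ _ a3) //; last first.
    have step (i j : 'I_n) : j \in porbit y a3 -> y j = i :> nat -> i \in porbit y a3.
      by move=> jP /ord_inj <-; apply: porbit_step.
    have [a1 E1] : exists i : 'I_n, i = 1%N :> nat by apply: exists_ord; lia.
    have [a2 E2] : exists i : 'I_n, i = 2%N :> nat by apply: exists_ord; lia.
    have P3 : a3 \in porbit y a3 by apply: porbit_id.
    have P2 : a2 \in porbit y a3.
      by apply: (step _ a3) => //; rewrite second_yE; split_ifs; lia.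
    have P1 : a1 \in porbit y a3.
      by apply: (step _ a2) => //; rewrite second_yE; split_ifs; lia.
    have P0 : a0 \in porbit y a3.
      by apply: (step _ a1) => //; rewrite second_yE; split_ifs; lia.
    have Pp m' (i : 'I_n) : i = (p + m')%N :> nat -> i \in porbit y a3.
      elim: m' i => [|m' IH] i iE.
        by apply: (step _ a0) => //; rewrite second_yE; split_ifs; lia.
      have [j jE] : exists j : 'I_n, j = (p + m')%N :> nat.
        by apply: exists_ord; have := ltn_ord i; lia.
      apply: (step _ j); first exact: IH.
      by have := ltn_ord i; rewrite second_yE; split_ifs; lia.
    move=> i; rewrite -val_eqE /= second_yE => yi.
    have [pi|ip] := leqP p i; first by apply: (Pp (i - p)%N); lia.
    have i4 : (i < 4)%N by move: yi; split_ifs; lia.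
    case: i i4 {yi ip} => [[|[|[|[|//]]]] lt] _.
    - by rewrite (_ : Ordinal lt = a0) //; apply: ord_inj; rewrite E0.
    - by rewrite (_ : Ordinal lt = a1) //; apply: ord_inj; rewrite E1.
    - by rewrite (_ : Ordinal lt = a2) //; apply: ord_inj; rewrite E2.
    - by rewrite (_ : Ordinal lt = a3) //; apply: ord_inj; rewrite E3.
  rewrite (_ : fixpts y = [set i : 'I_n | 4 <= i < p]%N).
    by rewrite card_interval; lia.
  apply/setP=> i; rewrite !inE -val_eqE /= second_yE.
  by have := ltn_ord i; split_ifs; lia.
rewrite second_xy in um1 *.
rewrite (@fixptsX_cycle _ _ a3) // ?card_fixpts_block_cycle; try lia.
by move=> i; apply: block_cycle_porbit; lia.
Qed.

(** The involution is [i -> 3 - i] modulo [p] on the cycle of [x], and it reverses both arcs 3, 2,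
    1, 0 and [p], ..., [n - 1] of the cycle of [y]. *)
Lemma second_reflJ : x ^ second_refl = x^-1 /\ y ^ second_refl = y^-1.
Proof.
have E i : second_refl i = (if i < 4 then 3 - i else
    if i < p then p + 3 - i else n.-1 + p - i)%N :> nat.
  by have := ltn_ord i; rewrite !permM !block_revE; try lia; split_ifs; lia.
have xE := second_xE; have yE := second_yE.
move: (second_refl) (x) (y) E xE yE => b x' y' E xE yE.
split; apply: conjg_eqV; apply/permP=> i; apply: ord_inj; have := ltn_ord i.
  by rewrite !permM xE !E xE; split_ifs; lia.
by rewrite !permM yE !E yE; split_ifs; lia.
Qed.

Lemma odd_second_refl : odd_perm second_refl = odd (n.-1)./2.
Proof. by rewrite !odd_permM !odd_block_rev; lia. Qed.

Lemma second_xX_neq1 m : (0 < m < p)%N -> x ^+ m != 1.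
Proof.
have [a0 E0] : exists i : 'I_n, i = 0%N :> nat by apply: exists_ord; lia.
move=> mp; apply/eqP => /permP /(_ a0) /(congr1 val) /=.
by rewrite perm1 (@block_cycleXE _ _ _ _ _ _ 0) ?add0n ?modn_small; lia.
Qed.

End SecondPair.

(** * Beauville structures on powers of the alternating group *)

Section AltPower.

Variables (n k : nat).
Let gT := {dffun forall i : 'I_k, {perm 'I_n}}.

Lemma mem_Alt_power (x y : gT) :
  (forall j, <<[set x j; y j]>> = 'Alt_('I_n)) ->
  x \in Alt_power n k /\ y \in Alt_power n k.
Proof.
move=> gen; have memA (g : gT) : (forall j, g j \in 'Alt_('I_n)) -> g \in Alt_power n k.
  by move=> gA; apply/setXnP.
by split; apply: memA => j; rewrite -(gen j) mem_gen // !inE eqxx ?orbT.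
Qed.

Lemma Alt_power_gen (x y : gT) : (5 <= n)%N ->
  (forall j, <<[set x j; y j]>> = 'Alt_('I_n)) ->
  (forall i j, i != j -> exists2 h, h \in <<[set x; y]>> &
     ((h j == 1) && (h i != 1)) || ((h i == 1) && (h j != 1))) ->
  <<[set x; y]>> = Alt_power n k :> {set gT}.
Proof.
move=> n_ge5 gen sep; have simpA : simple 'Alt_('I_n).
  by apply: simple_Alt5; rewrite card_ord.
apply: subdirect_simple_power => //.
- apply: contraFN (solvable_AltF (T := 'I_n) _); first exact: abelian_sol.
  by rewrite card_ord.
- have [xA yA] := mem_Alt_power gen.
  by rewrite gen_subG; apply/subsetP=> g /set2P [] ->.
move=> i a; change (a \in 'Alt_('I_n) -> exists2 h, h \in <<[set x; y]>> & h i = a).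
rewrite -(gen i) => aP.
have : a \in dffun_morphism (fun=> {perm 'I_n}) i @* <<[set x; y]>>.
  by rewrite morphim_gen ?subsetT // morphimU !morphim_set1 ?inE.
by case/morphimP=> h _ Hh ->; exists h.
Qed.

Lemma SigmaP (x y g : gT) : g \in Sigma (Alt_power n k) x y ->
  exists2 u, u \in [:: x; y; x * y] & exists m h, g = (u ^+ m) ^ h.
Proof.
rewrite /Sigma; elim/big_ind: _ => [|A B IHA IHB|m _]; first by rewrite inE.
  by case/setUP.
case/bigcupP=> h _; rewrite !inE -orbA => /or3P [] /eqP->.
- by exists x; [rewrite !inE eqxx | exists m, h].
- by exists y; [rewrite !inE eqxx orbT | exists m, h].
- by exists (x * y); [rewrite !inE eqxx !orbT | exists m, h].
Qed.

Lemma Sigma1 (x y : gT) : x \in Alt_power n k -> 1 \in Sigma (Alt_power n k) x y.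
Proof.
(* The identity is [x] raised to the group order, the last index of the union. *)
move=> xA; rewrite /Sigma big_mkcond big_nat_recr //=.
apply/setUP; right; apply/bigcupP; exists 1; first exact: group1.
by rewrite !inE conjg1 expg_cardG ?eqxx.
Qed.

(** The number of fixed points of a coordinate is invariant under conjugation, so at a nontrivial
    coordinate of a common element the two conditions would contradict each other. *)
Lemma Sigma_fixpts_disjoint (x1 y1 x2 y2 : gT) :
  x1 \in Alt_power n k -> x2 \in Alt_power n k ->
  (forall j m u, u \in [:: x1 j; y1 j; x1 j * y1 j] -> u ^+ m != 1 ->
     #|fixpts (u ^+ m)| = 1%N \/ ~~ odd #|fixpts (u ^+ m)|) ->
  (forall j m u, u \in [:: x2 j; y2 j; x2 j * y2 j] -> u ^+ m != 1 ->
     odd #|fixpts (u ^+ m)| && (2 < #|fixpts (u ^+ m)|)%N) ->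
  Sigma (Alt_power n k) x1 y1 :&: Sigma (Alt_power n k) x2 y2 = [set 1].
Proof.
move=> A1 A2 fix1 fix2; apply/eqP; rewrite eqEsubset sub1set in_setI !Sigma1 // !andbT.
apply/subsetP=> g /setIP [/SigmaP [u u1 [m [h gE]]] /SigmaP [v v2 [m' [h' gE']]]].
have coord (w x y : gT) j : w \in [:: x; y; x * y] -> w j \in [:: x j; y j; x j * y j].
  by rewrite !inE => /or3P [] /eqP->; rewrite ?mulg_ffun eqxx ?orbT.
rewrite inE; apply/eqP/ffunP=> j; rewrite oneg_ffun; apply/eqP.
apply: contraT => gj1.
have {}gE : g j = (u j ^+ m) ^ h j by rewrite gE conjg_ffun expg_ffun.
have {}gE' : g j = (v j ^+ m') ^ h' j by rewrite gE' conjg_ffun expg_ffun.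
have := fix1 j m _ (coord u _ _ j u1); have := fix2 j m' _ (coord v _ _ j v2).
rewrite -(card_fixptsJ (v j ^+ m') (h' j)) -gE' -(card_fixptsJ (u j ^+ m) (h j)) -gE.
rewrite -(conjg_eq1 (v j ^+ m') (h' j)) -gE' -(conjg_eq1 (u j ^+ m) (h j)) -gE gj1.
by move=> /(_ isT) /andP [od gt] /(_ isT) []; lia.
Qed.

(** Conjugation by [b1] is an automorphism even when [b1] has odd coordinates. It inverts the first
    pair; the second is handled by the correction [b2^-1 * b1], which lies in the group because the
    parities agree. *)
Lemma strongly_real_Alt_power (x1 y1 x2 y2 b1 b2 : gT) :
  beauville_structure (Alt_power n k) x1 y1 x2 y2 ->
  (forall j, [/\ x1 j ^ b1 j = (x1 j)^-1 , y1 j ^ b1 j = (y1 j)^-1,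
     x2 j ^ b2 j = (x2 j)^-1 & y2 j ^ b2 j = (y2 j)^-1]) ->
  (forall j, odd_perm (b1 j) = odd_perm (b2 j)) ->
  strongly_real_beauville (Alt_power n k).
Proof.
move=> beau inv par; exists x1, y1, x2, y2; split=> //.
case: beau => [[x1A y1A x2A y2A] _ _ _].
have nb : b1 \in 'N(Alt_power n k).
  apply/normP/eqP; rewrite eqEcard cardJg leqnn andbT.
  apply/subsetP=> _ /imsetP [f /setXnP fA ->]; apply/setXnP=> j.
  rewrite conjg_ffun; have := fA j.
  by rewrite !Alt_even odd_permJ.
have phiE f : f \in Alt_power n k -> conj_aut (Alt_power n k) b1 f = f ^ b1.
  by apply: norm_conj_autE.
exists (conj_aut (Alt_power n k) b1), 1, (b2^-1 * b1).
have b21 : b2^-1 * b1 \in Alt_power n k.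
  apply/setXnP=> j; rewrite mulg_ffun invg_ffun.
  by rewrite Alt_even odd_permM odd_permV par addbb.
have conjb f : b2^-1 * b1 * f ^ b1 * (b2^-1 * b1)^-1 = f ^ b2.
  by rewrite invMg invgK !conjgE !mulgA !mulgK.
split; rewrite ?group1 //.
- by apply: (subsetP (Aut_conj_aut _ 'N(Alt_power n k))); apply: mem_morphim.
- by rewrite !mul1g !invg1 !mulg1 !phiE //; split; apply/ffunP=> j;
     rewrite conjg_ffun invg_ffun; case: (inv j).
- by rewrite !phiE // !conjb; split; apply/ffunP=> j;
     rewrite conjg_ffun invg_ffun; case: (inv j).
Qed.

End AltPower.

Theorem lemma18 (n k : nat) (n_ge12 : (12 <= n)%N) (n_even : ~~ odd n)
    (k_gt0 : (0 < k)%N) (k_le : (k%:R <= (n%:R - 8) / 4 :> rat)%R) :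
  strongly_real_beauville (Alt_power n k).
Proof.
have {k_le} kn : (4 * k + 8 <= n)%N.
  move: k_le; rewrite Num.Theory.ler_pdivlMr // Num.Theory.lerBrDr -!GRing.Theory.natrM.
  by rewrite -GRing.Theory.natrD Num.Theory.ler_nat mulnC.
case: n => // N in n_ge12 n_even kn *.
have N_odd : odd N by move: n_even; rewrite /= negbK.
pose w j := (2 * j.+1)%N; pose p j := (7 + 2 * j)%N.
have Hw (j : 'I_k) : [/\ ~~ odd (w j), 0 < w j & 2 * w j + 1 < N]%N.
  by have := ltn_ord j; rewrite /w; split; lia.
have Hp (j : 'I_k) : [/\ odd (p j), 7 <= p j & p j + 3 <= N.+1]%N.
  by have := ltn_ord j; rewrite /p; split; lia.
pose tup (f : nat -> {perm 'I_N.+1}) : {dffun forall i : 'I_k, {perm 'I_N.+1}} :=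
  [ffun j : 'I_k => f j].
have tupE f j : tup f j = f j by rewrite ffunE.
pose x1 := tup (fun _ => first_x N); pose y1 := tup (fun j => first_y N (w j)).
pose x2 := tup (fun j => second_x N.+1 (p j)).
pose y2 := tup (fun j => second_y N.+1 (p j)).
have gen1 j : <<[set x1 j; y1 j]>> = 'Alt_('I_N.+1).
  by rewrite !tupE; case: (Hw j) => *; apply: first_gen.
have gen2 j : <<[set x2 j; y2 j]>> = 'Alt_('I_N.+1).
  by rewrite !tupE; case: (Hp j) => *; apply: second_gen.
have in1 := mem_Alt_power gen1; have in2 := mem_Alt_power gen2.
apply: (@strongly_real_Alt_power _ _ x1 y1 x2 y2 (tup (fun j => first_refl N (w j)))
  (tup (fun j => second_refl N.+1 (p j)))).
- split.
  + by case: in1 in2 => ? ? [].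
  + apply: Alt_power_gen => //; first exact: leq_trans n_ge12.
    (* The word is trivial at [j] and, [w] being injective, nontrivial at [i]. *)
    move=> i j ij; exists (separating_word (2 * w j) x1 y1).
      have [gx gy] : x1 \in <<[set x1; y1]>> /\ y1 \in <<[set x1; y1]>>.
        by rewrite !mem_gen // !inE eqxx ?orbT.
      by rewrite groupX // groupM ?groupJ ?groupM ?groupV ?groupX.
    have swE l : separating_word (2 * w j) x1 y1 l =
        separating_word (2 * w j) (first_x N) (first_y N (w l)).
      by rewrite /separating_word expg_ffun !(mulg_ffun, conjg_ffun, invg_ffun,
           expg_ffun) !tupE.
    case: (Hw i) (Hw j) => i1 i2 i3 [j1 j2 j3].
    rewrite !swE separating_word_eq1 // separating_word_neq1 ?eqxx //.
    by move: ij; rewrite -val_eqE /w /=; lia.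
  + apply: Alt_power_gen => //; first exact: leq_trans n_ge12.
    have x2X l m : (x2 ^+ m) l = second_x N.+1 (p l) ^+ m.
      by rewrite expg_ffun tupE.
    have x2p (l : 'I_k) : second_x N.+1 (p l) ^+ p l = 1.
      by apply: block_cycle_order; case: (Hp l); lia.
    (* The smaller cycle length kills its own coordinate and is too small to kill the other. *)
    move=> i j ij; exists (x2 ^+ minn (p i) (p j)).
      by rewrite groupX // mem_gen // !inE eqxx.
    rewrite !x2X; case: (Hp i) (Hp j) => i1 i2 i3 [j1 j2 j3].
    move: ij; rewrite -val_eqE /= => ij.
    case: (ltngtP (p i) (p j)) => pij; last by move: pij ij; rewrite /p; lia.
      by rewrite x2p eqxx second_xX_neq1 ?orbT //; lia.
    by rewrite x2p eqxx second_xX_neq1 //; lia.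
  apply: Sigma_fixpts_disjoint; [by case: in1|by case: in2| |].
    by move=> j m u; rewrite !tupE; case: (Hw j) => *; apply: (@first_fixpts N (w j)).
  by move=> j m u; rewrite !tupE; case: (Hp j) => *; apply: (@second_fixpts N.+1 (p j)).
- move=> j; rewrite !tupE; case: (Hw j) (Hp j) => we w0 wl [po p7 pN].
  have [-> ->] := first_reflJ N_odd we w0 wl.
  by have [-> ->] := second_reflJ n_even po p7 pN.
move=> j; rewrite !tupE; case: (Hw j) (Hp j) => ? ? ? [? ? ?].
by rewrite odd_first_refl // odd_second_refl.
Qed.
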